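(* Let $1\leq k<d$ be integers and let $\theta\in(0,1)$. If $X\subseteq\mathbb{R}^d$ is bounded, then for $\gamma_{d,k}$-almost all $V\in G(d,k)$, \[ \overline{\dim}_{\mathrm{B}} P_V(X)\ \geq\ \overline{\dim}_{\mathrm{B}} X-\max\big\{0,\ \overline{\dim}_{\mathrm{A}}^{\theta}X-k,\ (\dim_{\mathrm{A}}X-k)(1-\theta)\big\}. \]
   Context: For non-empty bounded $E\subseteq\mathbb{R}^d$ and $r>0$, $N_r(E)$ is the minimal number of sets of diameter $r$ needed to cover $E$. The upper box dimension is $\overline{\dim}_{\mathrm{B}}E=\limsup_{r\to0}\frac{\log N_r(E)}{-\log r}$. The Assouad dimension $\dim_{\mathrm{A}}X$ is the infimum of $\alpha>0$ for which there is $C>0$ with $N_r(B(x,R)\cap X)\leq C(R/r)^\alpha$ for all $0<r<R$ and $x\in X$. The upper Assouad spectrum $\overline{\dim}_{\mathrm{A}}^{\theta}X$ (for $\theta\in(0,1)$) is the infimum of $\alpha$ for which there is $C>0$ with $N_r(B(x,R)\cap X)\leq C(R/r)^\alpha$ for all $0<r\leq R^{1/\theta}<R<1$ and all $x\in X$. $G(d,k)$ is the Grassmannian of $k$-dimensional linear subspaces of $\mathbb{R}^d$, equipped with the rotation-invariant Borel probability measure $\gamma_{d,k}$; $P_V:\mathbb{R}^d\to V$ is orthogonal projection onto $V$ (with $V$ identified with $\mathbb{R}^k$). *)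

(* Defs.v *)
From HB Require Import structures.
From mathcomp Require Import all_boot all_order all_algebra.
From mathcomp Require Import all_classical all_reals all_analysis.
Set Implicit Arguments. Unset Strict Implicit. Unset Printing Implicit Defensive.
Import Order.TTheory GRing.Theory Num.Theory.
Import numFieldNormedType.Exports.
Local Open Scope classical_set_scope.
Local Open Scope ring_scope.

Section Defs.
Variable R : realType.

Definition edist (d : nat) (x y : 'rV[R]_d) : R :=
  Num.sqrt (\sum_(i < d) (x ord0 i - y ord0 i) ^+ 2).

(* Euclidean diameter (in \bar R; the empty set has diameter -oo). *)
Definition ediam (d : nat) (E : set 'rV[R]_d) : \bar R :=
  ereal_sup [set (edist p.1 p.2)%:E | p in E `*` E].

Definition eball (d : nat) (x : 'rV[R]_d) (r : R) : set 'rV[R]_d :=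
  [set y | edist x y < r].

Definition ebounded (d : nat) (X : set 'rV[R]_d) : Prop :=
  exists M : R, forall x, X x -> edist 0 x <= M.

Definition coverable (d : nat) (E : set 'rV[R]_d) (r : R) (n : nat) : Prop :=
  exists F : nat -> set 'rV[R]_d,
    (forall i, (i < n)%N -> (ediam (F i) <= r%:E)%E) /\
    E `<=` \bigcup_(i in [set i : nat | (i < n)%N]) F i.

(* N_r(E): minimal number of sets of diameter r covering E (+oo if none). *)
Definition covnum (d : nat) (E : set 'rV[R]_d) (r : R) : \bar R :=
  ereal_inf [set (n%:R)%:E | n in [set n : nat | coverable E r n]].

Definition box_ratio (d : nat) (E : set 'rV[R]_d) (r : R) : \bar R :=
  match covnum E r with
  | EFin N => (ln N / - ln r)%:E
  | +oo%E => +oo%E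
  | -oo%E => -oo%E
  end.

Definition upper_box_dim (d : nat) (E : set 'rV[R]_d) : \bar R :=
  limf_esup (box_ratio E) (0%R)^'+.

Definition assouad_dim (d : nat) (X : set 'rV[R]_d) : \bar R :=
  ereal_inf [set a%:E | a in [set a : R | 0 < a /\
    exists C : R, 0 < C /\
      forall (r Rr : R) (x : 'rV[R]_d), 0 < r -> r < Rr -> X x ->
        (covnum (eball x Rr `&` X) r <= (C * (Rr / r) `^ a)%:E)%E]].

Definition upper_assouad_spectrum (d : nat) (theta : R) (X : set 'rV[R]_d)
  : \bar R :=
  ereal_inf [set a%:E | a in [set a : R | 0 < a /\
    exists C : R, 0 < C /\
      forall (r Rr : R) (x : 'rV[R]_d),
        0 < r -> r <= Rr `^ theta^-1 -> Rr `^ theta^-1 < Rr -> Rr < 1 ->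
        X x ->
        (covnum (eball x Rr `&` X) r <= (C * (Rr / r) `^ a)%:E)%E]].

(* G(d,k), each V represented by its orthogonal projection matrix P_V
   (symmetric, idempotent, rank k). *)
Definition grass (d k : nat) : set 'M[R]_d :=
  [set P | P^T = P /\ P *m P = P /\ \rank P = k].

Definition projV (d : nat) (P : 'M[R]_d) (X : set 'rV[R]_d) : set 'rV[R]_d :=
  [set x *m P | x in X].

Definition BorelMx (d : nat) := g_sigma_algebraType (@open 'M[R]_d).

(* gamma_{d,k}: a Borel probability measure concentrated on G(d,k),
   invariant under rotations (V |-> U V, i.e. P |-> U P U^T). *)
Definition rotation_invariant_grass_measure (d k : nat)
  (gamma : probability (BorelMx d) R) : Prop :=
  gamma (@grass d k : set (BorelMx d)) = 1%E /\
  forall U : 'M[R]_d, U *m U^T = 1%:M ->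
    forall A : set (BorelMx d), measurable A ->
      gamma ((fun P : BorelMx d => (U *m P *m U^T : BorelMx d)) @^-1` A)
      = gamma A.

End Defs.

(* Main.v *)
Require Import Defs.
From mathcomp Require Import all_boot all_order all_algebra.
From mathcomp Require Import all_classical all_reals all_analysis.
From mathcomp Require Import measurable_realfun ring lra zify.
Set Implicit Arguments.
Unset Strict Implicit.
Unset Printing Implicit Defensive.
Import Order.TTheory GRing.Theory Num.Theory.
Import numFieldNormedType.Exports.
Local Open Scope classical_set_scope.
Local Open Scope ring_scope.

(**
A second moment argument.  Let [x_1, ..., x_n] be [rho]-separated points of [X],
with [n] close to the covering number of [X] at scale [rho].  If the projection
of [X] to [V] is covered by [N] sets of diameter [rho], then by Cauchy-Schwarz at
least [n ^ 2 / N] pairs have projections within [rho] of each other.  The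
[gamma]-measure of the planes bringing the projections of [x] and [y] within
[rho] is at most a constant times [(rho / (rho + |x - y|)) ^ k].  Let [m] exceed
the maximum in the theorem.  The spectrum (for [rho <= R ^ (1 / theta)]) and the
Assouad dimension (for smaller [R]) both bound the number of points in a ball of
radius [R < 1] by a constant times [rho ^ (- m) * (R / rho) ^ k].  Summing over
dyadic shells [|x - y| ~ R], the expected number of close pairs is at most
[n * rho ^ (- m - e)] up to a constant, for every [e > 0].  By Markov's
inequality [N >= n * rho ^ (m + 2 e)] outside a set of planes of measure
[O(rho ^ e)], and such sets are available at arbitrarily small scales.

The estimate for a single pair uses only the invariance of [gamma]: the measure
depends on [|x - y|] alone, so it can be averaged over the directions of the
points of the grid [{0, ..., n} ^ d], and an [O(1)]-neighbourhood of a
[(d - k)]-plane contains [O(n ^ (d - k))] of these points.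
*)

(* Without this notation, [edist] is the extended distance of MathComp-Analysis. *)
Local Notation edist := Defs.edist.

(** * Grid points close to a subspace *)

Section MaximalMinor.
Variable F : realFieldType.

Lemma det_replace_col k d (Q : 'M[F]_(k, d)) (f g : 'I_k -> 'I_d) (i : 'I_k) :
  colsub f Q = 1%:M -> (forall b, b != i -> g b = f b) ->
  \det (colsub g Q) = Q i (g i).
Proof.
move=> fQ gf.
have gQE a b : b != i -> colsub g Q a b = (a == b)%:R.
  by move=> bi; move/matrixP/(_ a b): fQ; rewrite !mxE gf.
rewrite (expand_det_row _ i) (bigD1 i) //= big1 ?addr0 => [|b bi]; last first.
  by rewrite gQE // eq_sym (negbTE bi) mul0r.
rewrite /cofactor.
have -> : row' i (col' i (colsub g Q)) = 1%:M.
  apply/matrixP => a b; rewrite 2!mxE gQE; last by rewrite eq_sym neq_lift.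
  by rewrite mxE (inj_eq (@lift_inj _ i)).
by rewrite det1 mulr1 mxE -signr_odd oddD addbb expr0 mulr1.
Qed.

Lemma exists_max_minor k d (B : 'M[F]_(k, d)) : row_free B ->
  exists f : {ffun 'I_k -> 'I_d}, colsub f B \in unitmx /\
    forall g : {ffun 'I_k -> 'I_d}, `|\det (colsub g B)| <= `|\det (colsub f B)|.
Proof.
move=> Bfree; have Bfull : row_full B^T by rewrite /row_full mxrank_tr.
pose f0 := finfun (fullrankfun Bfull).
have f0B : \det (colsub f0 B) != 0.
  rewrite -unitfE -unitmxE -unitmx_tr.
  rewrite (_ : _^T = rowsub (fullrankfun Bfull) B^T) ?fullrowsub_unit //.
  by apply/matrixP => a b; rewrite !mxE ffunE.
have [f _ fmax] := @Order.TotalTheory.arg_maxP _ _ _ f0 xpredT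
  (fun g : {ffun 'I_k -> 'I_d} => `|\det (colsub g B)|) isT.
exists f; split => [|g]; last exact: fmax.
by rewrite unitmxE unitfE -normr_gt0; apply: lt_le_trans (fmax f0 isT); rewrite normr_gt0.
Qed.

(* Cramer's rule: once a maximal minor is normalized to the identity, the other
   entries are quotients of minors by it. *)
Lemma exists_bounded_row_basis m d (A : 'M[F]_(m, d)) :
  exists (f : 'I_(\rank A) -> 'I_d) (Q : 'M[F]_(\rank A, d)),
    [/\ (Q :=: A)%MS, colsub f Q = 1%:M & forall i j, `|Q i j| <= 1].
Proof.
have [f [fB fmax]] := exists_max_minor (row_base_free A).
set B := row_base A in fB fmax *; pose Q := invmx (colsub f B) *m B.
have subQ g : colsub g Q = invmx (colsub f B) *m colsub g B.
  by apply/matrixP => a b; rewrite !mxE; apply: eq_bigr => c _; rewrite !mxE.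
have fQ : colsub f Q = 1%:M by rewrite subQ mulVmx.
exists f, Q; split => // [|i j].
  apply: eqmx_trans (eq_row_base A); apply: eqmxMfull.
  by rewrite row_full_unit unitmx_inv.
pose g : {ffun 'I__ -> 'I_d} := [ffun b => if b == i then j else f b].
have gi : g i = j by rewrite ffunE eqxx.
have := @det_replace_col _ _ Q f g i fQ.
rewrite gi => <-; last by move=> b bi; rewrite ffunE (negbTE bi).
rewrite subQ det_mulmx det_inv normrM normfV mulrC ler_pdivrMr ?mul1r //.
by rewrite normr_gt0 -unitfE -unitmxE.
Qed.

Lemma colsub_eq1_inj k d (Q : 'M[F]_(k, d)) (f : 'I_k -> 'I_d) :
  colsub f Q = 1%:M -> injective f.
Proof.
move=> fQ a b ab; apply/eqP; move/matrixP/(_ a b): (fQ).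
move/matrixP/(_ a a): fQ; rewrite !mxE ab eqxx => ->.
by case: (a == b) => // /eqP; rewrite oner_eq0.
Qed.

Lemma mulmx_tr_colsub k d (Q : 'M[F]_(k, d)) (f : 'I_k -> 'I_d) (u : 'rV[F]_d) :
  colsub f Q = 1%:M -> (forall j, j \notin codom f -> u ord0 j = 0) ->
  u *m Q^T = colsub f u.
Proof.
move=> fQ u0; apply/rowP => a; rewrite !mxE (bigD1 (f a)) //= big1 ?addr0 => [|j jfa].
  by rewrite mxE; move/matrixP/(_ a a): fQ; rewrite !mxE eqxx => ->; rewrite mulr1.
case: (boolP (j \in codom f)) => [/codomP [b jb]|/u0 ->]; last by rewrite mul0r.
move/matrixP/(_ a b): fQ; rewrite !mxE -jb => ->.
by case: eqP => [ab|_]; rewrite ?mulr0 //; rewrite jb ab eqxx in jfa.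
Qed.

End MaximalMinor.

Definition enorm (F : rcfType) d (z : 'rV[F]_d) : F :=
  Num.sqrt (\sum_(i < d) z ord0 i ^+ 2).

Section EuclideanNorm.
Variables (F : rcfType) (d : nat).
Implicit Types z u : 'rV[F]_d.

Lemma enorm_ge0 z : 0 <= enorm z.
Proof. exact: sqrtr_ge0. Qed.

Lemma sqr_enorm z : enorm z ^+ 2 = \sum_(i < d) z ord0 i ^+ 2.
Proof. by rewrite sqr_sqrtr // sumr_ge0 // => i _; rewrite sqr_ge0. Qed.

Lemma mulmx_tr_enorm z : z *m z^T = (enorm z ^+ 2)%:M.
Proof.
rewrite [LHS]mx11_scalar mxE sqr_enorm; congr (_%:M).
by apply: eq_bigr => i _; rewrite mxE expr2.
Qed.

Lemma enorm_eq0 z : (enorm z == 0) = (z == 0).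
Proof.
rewrite -sqrf_eq0 sqr_enorm.
apply/eqP/eqP => [/psumr_eq0P sqr0|->]; last by rewrite big1 // => i _; rewrite mxE expr0n.
apply/rowP => i; rewrite mxE; apply/eqP; rewrite -sqrf_eq0.
by apply/eqP/sqr0 => // j _; rewrite sqr_ge0.
Qed.

Lemma enorm_gt0 z : (0 < enorm z) = (z != 0).
Proof. by rewrite lt_def enorm_eq0 enorm_ge0 andbT. Qed.

Lemma enorm0 : enorm (0 : 'rV[F]_d) = 0.
Proof. by apply/eqP; rewrite enorm_eq0. Qed.

Lemma enormZ c z : enorm (c *: z) = `|c| * enorm z.
Proof.
rewrite /enorm -sqrtr_sqr -sqrtrM ?sqr_ge0 // mulr_sumr.
by congr Num.sqrt; apply: eq_bigr => i _; rewrite mxE exprMn.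
Qed.

Lemma enormN z : enorm (- z) = enorm z.
Proof. by rewrite -scaleN1r enormZ normrN1 mul1r. Qed.

Lemma enorm_mul_orthogonal z (U : 'M[F]_d) : U *m U^T = 1%:M -> enorm (z *m U) = enorm z.
Proof.
move=> UU; apply/eqP; rewrite -(eqrXn2 (ltn0Sn 1)) ?enorm_ge0 //; apply/eqP.
have := mulmx_tr_enorm (z *m U).
by rewrite trmx_mul mulmxA -(mulmxA z) UU mulmx1 mulmx_tr_enorm => /matrixP/(_ 0 0);
  rewrite !mxE eqxx.
Qed.

Lemma normr_coord_le_enorm z i : `|z ord0 i| <= enorm z.
Proof.
rewrite -sqrtr_sqr ler_sqrt; last by rewrite sumr_ge0 // => j _; rewrite sqr_ge0.
by rewrite (bigD1 i) //= lerDl sumr_ge0 // => j _; rewrite sqr_ge0.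
Qed.

(* Cauchy-Schwarz in the form [2 z u |z| |u| <= |u|^2 z^2 + |z|^2 u^2],
   summed over the coordinates. *)
Lemma ler_enormD z u : enorm (z + u) <= enorm z + enorm u.
Proof.
have [->|z0] := eqVneq z 0; first by rewrite add0r enorm0 add0r.
have [->|u0] := eqVneq u 0; first by rewrite addr0 enorm0 addr0.
have zu0 : 0 < enorm z * enorm u by rewrite mulr_gt0 ?enorm_gt0.
rewrite -ler_sqr ?nnegrE ?addr_ge0 ?enorm_ge0 // -(ler_pM2l zu0).
have -> : enorm z * enorm u * enorm (z + u) ^+ 2 =
    \sum_i enorm z * enorm u * (z ord0 i + u ord0 i) ^+ 2.
  by rewrite sqr_enorm mulr_sumr; apply: eq_bigr => i _; rewrite mxE.
have -> : enorm z * enorm u * (enorm z + enorm u) ^+ 2 =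
    \sum_i (enorm u * (enorm z + enorm u) * z ord0 i ^+ 2 +
            enorm z * (enorm z + enorm u) * u ord0 i ^+ 2).
  by rewrite big_split /= -!mulr_sumr -!sqr_enorm; ring.
apply: ler_sum => i _; rewrite -subr_ge0.
suff -> : forall a b x y : F, a * (b + a) * x ^+ 2 + b * (b + a) * y ^+ 2 -
    b * a * (x + y) ^+ 2 = (a * x - b * y) ^+ 2 by exact: sqr_ge0.
by move=> a b x y; ring.
Qed.

Lemma ler_enormB z u : enorm (z - u) <= enorm z + enorm u.
Proof. by rewrite -[in leRHS](enormN u) ler_enormD. Qed.

(* The Householder reflection in the hyperplane orthogonal to [z - z']. *)
Lemma exists_orthogonal_symmetric_mul z z' : enorm z = enorm z' ->
  exists U : 'M[F]_d, [/\ U^T = U, U *m U = 1%:M & z *m U = z'].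
Proof.
move=> zz; have [<-|nzz] := eqVneq z z'.
  by exists 1%:M; rewrite trmx1 !mulmx1.
set v := z - z'; set q := enorm v ^+ 2; pose b := 2 / q.
have q0 : q != 0 by rewrite sqrf_eq0 enorm_eq0 subr_eq0.
have zv : z *m v^T = (q / 2)%:M.
  rewrite [LHS]mx11_scalar; congr (_%:M); rewrite mxE.
  apply: (@mulIf _ 2) => //; rewrite divfK //.
  have -> : q = q + (enorm z ^+ 2 - enorm z' ^+ 2) by rewrite zz subrr addr0.
  rewrite /q !sqr_enorm -sumrB -big_split /= mulr_suml; apply: eq_bigr => i _.
  by rewrite !mxE; ring.
exists (1%:M - b *: (v^T *m v)); split.
- by rewrite linearB /= linearZ /= trmx1 trmx_mul trmxK.
- have vvvv : v^T *m v *m (v^T *m v) = q *: (v^T *m v).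
    by rewrite mulmxA -(mulmxA v^T v) mulmx_tr_enorm mul_mx_scalar -scalemxAl.
  rewrite mulmxBl mul1mx [_ *m (1%:M - _)]mulmxBr mulmx1 -scalemxAl -scalemxAr vvvv !scalerA.
  have -> : b * b * q = b + b by rewrite /b; field.
  by rewrite scalerDl opprB addrK subrK.
- rewrite mulmxBr mulmx1 -scalemxAr mulmxA zv mul_scalar_mx scalerA.
  have -> : b * (q / 2) = 1 by rewrite /b; field.
  by rewrite scale1r opprB addrC subrK.
Qed.

Lemma coord_le_of_orthogonal_projection k (P : 'M[F]_d) (Q : 'M[F]_(k, d))
    (f : 'I_k -> 'I_d) (u : 'rV[F]_d) :
  P^T = P -> Q *m P = Q -> colsub f Q = 1%:M -> (forall i j, `|Q i j| <= 1) ->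
  (forall j, j \notin codom f -> u ord0 j = 0) ->
  forall a, `|u ord0 (f a)| <= d%:R * enorm (u *m P).
Proof.
move=> Psym QP fQ Qle1 u0 a.
have -> : u ord0 (f a) = (u *m P *m Q^T) ord0 a.
  by rewrite -mulmxA -{1}Psym -trmx_mul QP (mulmx_tr_colsub fQ u0) mxE.
rewrite mxE; apply: le_trans (ler_norm_sum _ _ _) _.
apply: le_trans (_ : \sum_(j < d) enorm (u *m P) <= _); last first.
  by rewrite sumr_const card_ord mulr_natl.
apply: ler_sum => j _; rewrite normrM [Q^T _ _]mxE -[leRHS]mulr1.
by apply: ler_pM => //; exact: normr_coord_le_enorm.
Qed.

End EuclideanNorm.

Lemma eq_of_eqn_mod_near D p q :
  p = q %[mod D.+1] -> (p <= q + D)%N -> (q <= p + D)%N -> p = q.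
Proof.
wlog pq : p q / (p <= q)%N => [wlog_le|] modE pD qD.
  by case: (leqP p q) => [/wlog_le|/ltnW/wlog_le] H; [apply: H|apply/esym/H].
move/esym/eqP: modE; rewrite eqn_mod_dvd // => dvd_qp.
apply/eqP; rewrite eqn_leq pq /= -subn_eq0.
have : (q - p <= D)%N by lia.
by case: (q - p)%N dvd_qp => // m /dvdn_leq; lia.
Qed.

(* Modulo [D.+1], two values at distance at most [D] can be told apart. *)
Lemma card_ffun_le_of_near (I J : finType) n D (f : J -> I)
    (A : {set {ffun I -> 'I_n}}) : injective f ->
  (forall w w', w \in A -> w' \in A -> (forall i, i \notin codom f -> w i = w' i) ->
    forall j, (w (f j) <= w' (f j) + D)%N) ->
  (#|A| <= n ^ (#|I| - #|J|) * D.+1 ^ #|J|)%N.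
Proof.
move=> finj near; pose off := {i : I | i \notin codom f}.
pose h (w : {ffun I -> 'I_n}) : {ffun off -> 'I_n} * {ffun J -> 'I_D.+1} :=
  ([ffun i => w (val i)], [ffun j => inord (w (f j) %% D.+1)]).
have hinj : {in A &, injective h}.
  move=> w w' wA w'A [/ffunP hoff /ffunP hmod].
  have offE i : i \notin codom f -> w i = w' i.
    by move=> fi; have := hoff (exist _ i fi); rewrite !ffunE.
  apply/ffunP => i; case: (boolP (i \in codom f)) => [/codomP [j ->]|/offE //].
  have /(congr1 val) := hmod j; rewrite !ffunE /= !inordK ?ltn_pmod // => modE.
  by apply/val_inj/(eq_of_eqn_mod_near modE); apply: near => // ? /offE.
rewrite -(card_in_imset hinj); apply: leq_trans (max_card _) _.
rewrite card_prod !card_ffun !card_ord card_sig -(card_codom finj).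
by rewrite -(cardC (mem (codom f))) addKn.
Qed.

Section GridPoints.
Variables (F : rcfType) (d n : nat).

Definition grid_point (w : {ffun 'I_d -> 'I_n.+1}) : 'rV[F]_d := \row_i (w i)%:R.

Lemma enorm_grid_point_le w : enorm (grid_point w) <= d%:R * n%:R.
Proof.
have dn0 : 0 <= d%:R * n%:R :> F by rewrite mulr_ge0.
rewrite -[leRHS](ger0_norm dn0) -sqrtr_sqr ler_sqrt ?sqr_ge0 //.
apply: le_trans (_ : \sum_(i < d) n%:R ^+ 2 <= _).
  by apply: ler_sum => i _; rewrite mxE lerXn2r ?nnegrE ?ler_nat // -ltnS.
rewrite sumr_const card_ord -[leLHS]mulr_natl exprMn ler_wpM2r ?sqr_ge0 //.
by rewrite -natrX ler_nat; case: (d) => // m; rewrite leq_pmulr.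
Qed.

Lemma card_grid_point_small_projection (P : 'M[F]_d) (c : nat) :
  P^T = P -> P *m P = P ->
  (#|[set w | (enorm (grid_point w *m P) <= c%:R)%R]%SET|
   <= n.+1 ^ (d - \rank P) * (2 * d * c).+1 ^ \rank P)%N.
Proof.
move=> Psym PP; have [f [Q [QP fQ Qle1]]] := exists_bounded_row_basis P.
have /submxP [M QM] : (Q <= P)%MS by rewrite QP.
have {QM}QP : Q *m P = Q by rewrite QM -mulmxA PP.
rewrite -[X in (_ ^ (X - _))%N]card_ord -(card_ord (\rank P)).
apply: (card_ffun_le_of_near (colsub_eq1_inj fQ)) => w w'.
rewrite !inE => wP w'P ww' a.
pose u := grid_point w - grid_point w'.
have u0 j : j \notin codom f -> u ord0 j = 0.
  by move=> fj; rewrite !mxE ww' // subrr.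
have := coord_le_of_orthogonal_projection Psym QP fQ Qle1 u0 a.
have /le_trans := ler_enormB (grid_point w *m P) (grid_point w' *m P).
move=> /(_ _ (lerD wP w'P)); rewrite -mulmxBl -/u => uP.
move=> /(le_trans (ler_norm _))/le_trans/(_ (ler_wpM2l (ler0n _ d) uP)).
by rewrite !mxE lerBlDl -natrD -natrM -natrD ler_nat addnn -mul2n mulnCA mulnA.
Qed.

End GridPoints.

(** * Counting and Markov's inequality *)

Lemma leq_sqr_sum (T : finType) (a : T -> nat) :
  ((\sum_t a t) ^ 2 <= #|T| * \sum_t a t ^ 2)%N.
Proof.
rewrite -(leq_pmul2l (m := 2)) // -mulnn big_distrlr big_distrr /=.
apply: (@leq_trans (\sum_s \sum_t (a s ^ 2 + a t ^ 2))%N).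
  by apply: leq_sum => s _; rewrite big_distrr; apply: leq_sum => t _; apply: nat_Cauchy.
under eq_bigr do rewrite big_split /= sum_nat_const.
by rewrite big_split /= sum_nat_const -big_distrr /= mul2n addnn.
Qed.

Lemma leq_sqr_card_collisions (I T : finType) (c : I -> T) :
  (#|I| ^ 2 <= #|T| * \sum_(p : I * I) (c p.1 == c p.2))%N.
Proof.
pose fiber t := (\sum_i (c i == t))%N.
have sum1 i : (\sum_t (c i == t) = 1)%N.
  by rewrite (bigD1 (c i)) //= eqxx big1 // => t /negbTE; rewrite eq_sym => ->.
have -> : #|I| = (\sum_t fiber t)%N.
  by rewrite exchange_big -sum1_card; apply: eq_bigr => i _; rewrite sum1.
suff <- : (\sum_t fiber t ^ 2 = \sum_(p : I * I) (c p.1 == c p.2))%N.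
  exact: leq_sqr_sum.
rewrite -(pair_bigA _ (fun i j => (c i == c j) : nat)) /=.
transitivity (\sum_t \sum_i \sum_j (c i == t) * (c j == t))%N.
  by apply: eq_bigr => t _; rewrite -mulnn big_distrlr.
rewrite exchange_big /=; apply: eq_bigr => i _.
rewrite exchange_big /=; apply: eq_bigr => j _.
rewrite (bigD1 (c i)) //= eqxx mul1n big1 ?addn0 => [|t /negbTE]; first by rewrite eq_sym.
by rewrite eq_sym => ->.
Qed.

Section Hits.
Context (R : realType) (dsp : measure_display) (T : measurableType dsp).
Variables (mu : {measure set T -> \bar R}) (I : finType) (B : I -> set T).
Hypothesis mB : forall i, measurable (B i).

Definition hits (x : T) : R := \sum_i \1_(B i) x.

Lemma hits_ge0 x : 0 <= hits x.
Proof. by apply: sumr_ge0 => i _; rewrite indicE. Qed.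

Lemma hits_card x : hits x = #|[set i | `[< B i x >]]%SET|%:R.
Proof.
rewrite -sum1_card natr_sum [RHS]big_mkcond; apply: eq_bigr => i _.
by rewrite indicE finset.in_set; case: asboolP => Bx; [rewrite mem_set|rewrite memNset].
Qed.

Lemma measurable_hits : measurable_fun setT hits.
Proof. by apply: measurable_sum => i; apply: measurable_indic. Qed.

Lemma measurable_hits_ge (c : R) : measurable [set x | c <= hits x].
Proof.
have -> : [set x | c <= hits x] = setT `&` hits @^-1` `[c, +oo[.
  by rewrite setTI; apply/seteqP; split => x /=; rewrite in_itv /= andbT.
exact: measurable_hits.
Qed.

Lemma integral_hits : (\int[mu]_x (hits x)%:E = \sum_i mu (B i))%E.
Proof.
under eq_integral do rewrite /hits -sumEFin.
rewrite ge0_integral_sum //=.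
- by apply: eq_bigr => i _; rewrite integral_indic // setIT.
- by move=> i; apply/measurable_EFinP; apply: measurable_indic.
Qed.

Lemma sum_measure_le_of_ae_hits_le (c : R) : 0 <= c ->
  {ae mu, forall x, hits x <= c} -> (\sum_i mu (B i) <= c%:E * mu setT)%E.
Proof.
move=> c0 hits_le; rewrite -integral_hits -integral_cst //.
apply: ae_ge0_le_integral => //.
- by move=> x _; rewrite lee_fin hits_ge0.
- by apply/measurable_EFinP; exact: measurable_hits.
- by apply: filterS hits_le => x hc _; rewrite lee_fin.
Qed.

Lemma markov_hits (c : R) : 0 <= c ->
  (c%:E * mu [set x | c <= hits x]%R <= \sum_i mu (B i))%E.
Proof.
move=> c0; have mD := measurable_hits_ge c.
have mhits : measurable_fun setT (EFin \o hits).
  by apply/measurable_EFinP; exact: measurable_hits.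
rewrite -integral_hits -integral_cst //.
apply: (@le_trans _ _ (\int[mu]_(x in [set x | (c <= hits x)%R]) (hits x)%:E)%E).
  by apply: ge0_le_integral => //; exact: measurable_funTS.
by apply: ge0_subset_integral => // x _; rewrite lee_fin hits_ge0.
Qed.

End Hits.

(** * Measure of the subspaces almost orthogonal to a vector *)

Lemma trace_idempotent (F : fieldType) n (P : 'M[F]_n) :
  P *m P = P -> \tr P = (\rank P)%:R.
Proof.
have /row_freeP := row_base_free P; have /row_fullP := col_base_full P.
move: (mulmx_base P); move: (\rank P) (col_base P) (row_base P) => r A B <-.
move=> [C CA] [D BD] PP; rewrite mxtrace_mulC.
suff -> : B *m A = 1%:M by rewrite mxtrace_scalar.
have : C *m (A *m B *m (A *m B)) *m D = C *m (A *m B) *m D by rewrite PP.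
by rewrite !mulmxA CA !mul1mx -!mulmxA BD mulmx1.
Qed.

Section MatrixContinuity.
Variable R : realType.

Lemma continuous_sumr (T : topologicalType) (I : Type) (r : seq I) (f : I -> T -> R) :
  (forall i, continuous (f i)) -> continuous (fun x => \sum_(i <- r) f i x).
Proof.
by move=> cf; apply: (@continuous_big R I +%R 0 xpredT) => //; exact: add_continuous.
Qed.

Lemma continuous_mulmx_entry (T : topologicalType) m n p
    (A : T -> 'M[R]_(m, n)) (B : T -> 'M[R]_(n, p)) i j :
  (forall l, continuous (fun x => A x i l)) -> (forall l, continuous (fun x => B x l j)) ->
  continuous (fun x => (A x *m B x) i j).
Proof.
move=> cA cB; under eq_fun do rewrite mxE.
by apply: continuous_sumr => l x; apply: continuousM; [exact: cA|exact: cB].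
Qed.

Lemma continuous_enorm_mulmx d (z : 'rV[R]_d) :
  continuous (fun P : 'M[R]_d => enorm (z *m P)).
Proof.
move=> P; apply: (continuous_comp (f := fun P => \sum_i (z *m P) ord0 i ^+ 2));
  last exact: sqrt_continuous.
apply: continuous_sumr => i {}P.
apply: (continuous_comp (f := fun P => (z *m P) ord0 i) (g := fun x => x ^+ 2));
  last exact: exprn_continuous.
apply: continuous_mulmx_entry => l {}P; first exact: cst_continuous.
exact: coord_continuous.
Qed.

Lemma closed_eq_mx (T : topologicalType) m n (f g : T -> 'M[R]_(m, n)) :
  (forall i j, continuous (fun x => f x i j)) ->
  (forall i j, continuous (fun x => g x i j)) -> closed [set x | f x = g x].
Proof.
move=> cf cg.
have -> : [set x | f x = g x] =
    \bigcap_(p in [set: 'I_m * 'I_n]) [set x | f x p.1 p.2 - g x p.1 p.2 = 0].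
  apply/seteqP; split => x /= fg; first by move=> p _; rewrite /= fg subrr.
  by apply/matrixP => i j; apply/eqP; rewrite -subr_eq0; apply/eqP/(fg (i, j)).
apply: closed_bigI => p _.
have cfg : continuous (fun x => f x p.1 p.2 - g x p.1 p.2).
  by move=> x; apply: continuousB; [exact: cf|exact: cg].
exact: (continuous_closedP _).1 cfg _ (@closed_eq R 0).
Qed.

Lemma closed_grass d k : closed (@grass R d k).
Proof.
have -> : @grass R d k = [set P | P^T = P] `&` ([set P | P *m P = P] `&`
    [set P | \tr P = k%:R]).
  by apply/seteqP; split => P [Ps [PP rP]]; split => //; split => //; apply/eqP;
    move/eqP: rP; rewrite /= trace_idempotent // eqr_nat.
apply: closedI; last apply: closedI.
- apply: closed_eq_mx => i j; last exact: coord_continuous.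
  by under eq_fun do rewrite mxE; exact: coord_continuous.
- apply: closed_eq_mx => i j; last exact: coord_continuous.
  by apply: continuous_mulmx_entry => l; exact: coord_continuous.
- have ctr : continuous (fun P : 'M[R]_d => \tr P).
    by apply: continuous_sumr => i; exact: coord_continuous.
  exact: (continuous_closedP _).1 ctr _ (@closed_eq R k%:R).
Qed.

Lemma closed_measurable_mx d (A : set 'M[R]_d) :
  closed A -> measurable (A : set (BorelMx R d)).
Proof.
move=> cA; rewrite -[A]setCK; apply: measurableC.
by apply: sub_sigma_algebra; rewrite openC.
Qed.

End MatrixContinuity.

Section SmallProjections.
Variables (R : realType) (d k : nat) (gamma : probability (BorelMx R d) R).
Hypothesis gamma_inv : @rotation_invariant_grass_measure R d k gamma.
Implicit Types (z : 'rV[R]_d) (r : R).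

Lemma ae_grass : {ae gamma, forall P : BorelMx R d, @grass R d k P}.
Proof.
have mG : measurable (@grass R d k : set (BorelMx R d)).
  by apply: closed_measurable_mx; exact: closed_grass.
exists (~` @grass R d k : set (BorelMx R d)); split => //; first exact: measurableC.
by have [gamma1 _] := gamma_inv; rewrite probability_setC // gamma1 subee.
Qed.

Definition small_projection z r : set (BorelMx R d) := [set P | enorm (z *m P) <= r].

Lemma measurable_small_projection z r : measurable (small_projection z r).
Proof.
apply: closed_measurable_mx.
exact: (continuous_closedP _).1 (@continuous_enorm_mulmx R d z) _ (@closed_le R r).
Qed.

Lemma gamma_small_projection_eq z z' r : enorm z = enorm z' ->
  gamma (small_projection z r) = gamma (small_projection z' r).
Proof.
move=> /exists_orthogonal_symmetric_mul [U [Us UU zU]].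
have UUt : U *m U^T = 1%:M by rewrite Us.
have enormE P : enorm (z *m (U *m P *m U^T)) = enorm (z' *m P).
  by rewrite !mulmxA zU enorm_mul_orthogonal // !Us.
rewrite -(gamma_inv.2 U UUt _ (measurable_small_projection z r)).
by congr (gamma _); apply/seteqP; split => P; rewrite /small_projection /= enormE.
Qed.

Lemma gamma_small_projection_le_grid_point n (w : {ffun 'I_d -> 'I_n.+1}) z r :
  0 < r -> n%:R * r <= enorm z ->
  (gamma (small_projection z r) <= gamma (small_projection (grid_point R w) d%:R))%E.
Proof.
move=> r0 nrz; set v := grid_point R w.
have [v0|] := eqVneq v 0.
  rewrite [X in (_ <= gamma X)%E](_ : _ = setT); last first.
    by apply/seteqP; split => P //= _; rewrite /small_projection /= v0 mul0mx enorm0 ler0n.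
  by rewrite probability_setT probability_le1 //; exact: measurable_small_projection.
rewrite -enorm_gt0 => v0; have dnv := enorm_grid_point_le R w.
have dn0 : 0 < d%:R * n%:R :> R by exact: lt_le_trans dnv.
have n0 : 0 < n%:R :> R.
  by rewrite lt0r ler0n andbT; apply: contraTneq dn0 => ->; rewrite mulr0 ltxx.
have z0 : 0 < enorm z by apply: lt_le_trans nrz; rewrite mulr_gt0.
pose a := enorm z / enorm v; have a0 : 0 < a by rewrite divr_gt0.
have zav : enorm z = enorm (a *: v) by rewrite enormZ gtr0_norm // divfK ?gt_eqF.
rewrite (gamma_small_projection_eq r zav); apply: le_measure.
- by rewrite inE; exact: measurable_small_projection.
- by rewrite inE; exact: measurable_small_projection.
move=> P; rewrite /small_projection /= -scalemxAl enormZ gtr0_norm // => vPr.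
rewrite -(ler_pM2l a0); apply: le_trans vPr _.
rewrite /a mulrAC ler_pdivlMr //.
apply: le_trans (ler_wpM2l (ltW r0) dnv) _.
by rewrite mulrCA mulrC ler_wpM2r // mulrC.
Qed.

Lemma grass_measure_dim_le : (k <= d)%N.
Proof.
have [gamma1 _] := gamma_inv; rewrite leqNgt; apply/negP => dk.
have grass0 : @grass R d k = set0.
  apply/seteqP; split => // P [_ [_ rP]].
  by have := rank_leq_row P; rewrite rP leqNgt dk.
by move: gamma1; rewrite grass0 measure0 => /eqP; rewrite eqe eq_sym oner_eq0.
Qed.

(* The grid points serve as a discrete substitute for the uniform measure on
   the sphere. *)
Lemma gamma_small_projection_le_nat n z r : 0 < r -> n%:R * r <= enorm z ->
  (gamma (small_projection z r) <= (((2 * d * d).+1%:R / n.+1%:R) ^+ k)%:E)%E.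
Proof.
move=> r0 nrz; have kd := grass_measure_dim_le.
pose B (w : {ffun 'I_d -> 'I_n.+1}) := small_projection (grid_point R w) d%:R.
have mB w : measurable (B w) by exact: measurable_small_projection.
pose N := (n.+1 ^ (d - k) * (2 * d * d).+1 ^ k)%N.
have hits_le : {ae gamma, forall P : BorelMx R d, hits R B P <= N%:R}.
  apply: (@filterS _ _ (ae_filter_ringOfSetsType gamma)) ae_grass.
  move=> P [Psym [PP rP]]; rewrite hits_card ler_nat /N -rP.
  apply: leq_trans (card_grid_point_small_projection n d Psym PP).
  by apply/eq_leq/eq_card => w; rewrite !inE; apply/asboolP/idP.
have := sum_measure_le_of_ae_hits_le mB (ler0n _ _) hits_le.
rewrite [X in (_ <= _ * X)%E](_ : _ = 1%E) ?mule1; last exact: probability_setT.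
have gfin : gamma (small_projection z r) \is a fin_num.
  by apply: fin_num_measure; exact: measurable_small_projection.
have /le_trans/[apply] : (\sum_(w : {ffun 'I_d -> 'I_n.+1}) gamma (small_projection z r) <=
    \sum_w gamma (B w))%E.
  by apply: lee_sum => w _; exact: gamma_small_projection_le_grid_point.
rewrite -(fineK gfin) sumEFin !lee_fin sumr_const card_ffun !card_ord -[leLHS]mulr_natl.
rewrite /N natrM !natrX expr_div_n ler_pdivlMr ?exprn_gt0 //.
have -> : n.+1%:R ^+ d = n.+1%:R ^+ (d - k) * n.+1%:R ^+ k :> R by rewrite -exprD subnK.
by rewrite -mulrA ler_pM2l ?exprn_gt0 // mulrC.
Qed.

Definition projection_const : R := 2 * (2 * d * d).+1%:R.

Lemma gamma_small_projection_le z r : 0 < r ->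
  (gamma (small_projection z r) <= ((projection_const * (r / (r + enorm z))) ^+ k)%:E)%E.
Proof.
move=> r0; have z0 := enorm_ge0 z.
have /andP [nz zn] := truncn_itv (divr_ge0 z0 (ltW r0)).
move: (Num.truncn _) nz zn => n; rewrite ler_pdivlMr // ltr_pdivrMr // => nz zn.
apply: le_trans (gamma_small_projection_le_nat r0 nz) _; rewrite lee_fin.
have rz0 : 0 < r + enorm z by rewrite ltr_wpDr.
apply: lerXn2r; rewrite ?nnegrE ?mulr_ge0 ?invr_ge0 //; try exact: ltW.
rewrite /projection_const [2 * _]mulrC -mulrA ler_pM2l // mulrA ler_pdivlMr //.
rewrite ler_pdivrMl // mulr_natl mulrnAr -mulr_natl.
have : r <= n.+1%:R * r by rewrite ler_peMl ?ler1n // ltW.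
lra.
Qed.

End SmallProjections.

(** * Coverings and separated sets *)

Section Coverings.
Variables (R : realType) (d : nat).
Implicit Types (x y z : 'rV[R]_d) (E X : set 'rV[R]_d) (r : R) (n : nat).

Lemma edistE x y : edist x y = enorm (x - y).
Proof. by congr Num.sqrt; apply: eq_bigr => i _; rewrite !mxE. Qed.

Lemma edist_ge0 x y : 0 <= edist x y.
Proof. exact: sqrtr_ge0. Qed.

Lemma edistC x y : edist x y = edist y x.
Proof. by rewrite !edistE -enormN opprB. Qed.

Lemma edist_triangle y x z : edist x z <= edist x y + edist y z.
Proof. by rewrite !edistE -[x - z](subrKA y) ler_enormD. Qed.

Lemma ediam_leP E r :
  (ediam E <= r%:E)%E <-> forall x y, E x -> E y -> edist x y <= r.
Proof.
split=> [Er x y Ex Ey|Er].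
  by rewrite -lee_fin; apply: le_trans Er; apply: ereal_sup_ubound; exists (x, y).
by apply: ge_ereal_sup => _ [[x y] [/= Ex Ey] <-]; rewrite lee_fin Er.
Qed.

Lemma leq_coverable E r n m : (n <= m)%N -> coverable E r n -> coverable E r m.
Proof.
move=> nm [F [Fr EF]]; exists (fun i => if (i < n)%N then F i else set0); split.
  by move=> i _; case: ifP => [/Fr //|_]; apply/ediam_leP => x y.
move=> x /EF [i /= ni Fx]; exists i; first exact: leq_trans ni nm.
by rewrite ni.
Qed.

Lemma le_covnumP E r (c : R) :
  (c%:E <= covnum E r)%E <-> forall n, coverable E r n -> c <= n%:R.
Proof.
split=> [cE n En|cE]; last by apply/ereal_infP => _ [n En <-]; rewrite lee_fin cE.
by rewrite -lee_fin; apply: le_trans cE _; apply: ereal_inf_lbound; exists n.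
Qed.

Lemma coverable_of_covnum_lty E r : (covnum E r < +oo)%E -> exists n, coverable E r n.
Proof. by move=> /ereal_inf_ltP [_ [n En _] _]; exists n. Qed.

Definition separated (I : eqType) r (x : I -> 'rV[R]_d) : Prop :=
  forall i j, i != j -> r < edist (x i) (x j).

(* Greedy selection: balls of radius [r / 2] have diameter at most [r], so those
   around [n] points cannot cover [X]. *)
Lemma not_coverable_separated X r n : 0 <= r -> ~ coverable X r n ->
  exists x : 'I_n.+1 -> 'rV[R]_d, (forall i, X (x i)) /\ separated (r / 2) x.
Proof.
move=> r0; elim: n => [|n IHn] ncov.
  have [x Xx] : X !=set0.
    apply/set0P/eqP => X0; apply: ncov; exists (fun=> set0); split => //.
    by rewrite X0; exact: sub0set.
  by exists (fun=> x); split => // i j; rewrite !ord1.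
have [x [Xx sep]] := IHn (fun cov => ncov (leq_coverable (leqnSn n) cov)).
have [y Xy xy] : exists2 y, X y & forall i, r / 2 < edist (x i) y.
  apply: contrapT => no_point; apply: ncov.
  exists (fun i => [set y | edist (x (inord i)) y <= r / 2]); split => [i _|y Xy].
    apply/ediam_leP => y y' /= xy xy'.
    apply: le_trans (edist_triangle (x (inord i)) y y') _.
    by rewrite (splitr r) lerD // edistC.
  apply: contrapT => far; apply: no_point; exists y => // i; rewrite ltNge.
  by apply/negP => xy; apply: far; exists i => //=; rewrite inord_val.
exists (fun i => if unlift ord_max i is Some j then x j else y); split => [i|i j].
  by case: unliftP.
case: unliftP => [i' ->|->]; case: unliftP => [j' ->|->] //; last by rewrite eqxx.
  by move=> ij; apply: sep; apply: contraNneq ij => ->.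
by rewrite edistC.
Qed.

Lemma card_separated_le_covnum (I : finType) (x : I -> 'rV[R]_d) (A : {set I}) E r :
  (forall i, i \in A -> E (x i)) -> separated r x -> ((#|A|%:R)%:E <= covnum E r)%E.
Proof.
move=> AE sep; apply/le_covnumP => n [F [Fr EF]]; rewrite ler_nat.
have /choice [c cP] : forall i : {i | i \in A}, exists j : 'I_n, F j (x (val i)).
  by move=> i; have [j /= jn Fj] := EF _ (AE _ (valP i)); exists (Ordinal jn).
have cinj : injective c.
  move=> i j cij; apply/val_inj/eqP; apply: contraT => /sep.
  rewrite ltNge; have := cP j; rewrite -cij => Fj.
  by have /ediam_leP -> := Fr _ (ltn_ord (c i)).
by have := leq_card c cinj; rewrite card_sig card_ord.
Qed.

End Coverings.

(** * Covering numbers of balls *)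

Section BallCovering.
Variables (R : realType) (d : nat).
Implicit Types (X : set 'rV[R]_d) (x y : 'rV[R]_d) (a m s theta C r Rr : R).

Definition assouad_bound X a C : Prop :=
  forall r Rr x, 0 < r -> r < Rr -> X x ->
    (covnum (eball x Rr `&` X) r <= (C * (Rr / r) `^ a)%:E)%E.

Definition spectrum_bound theta X a C : Prop :=
  forall r Rr x, 0 < r -> r <= Rr `^ theta^-1 ->
    Rr `^ theta^-1 < Rr -> Rr < 1 -> X x ->
    (covnum (eball x Rr `&` X) r <= (C * (Rr / r) `^ a)%:E)%E.

Lemma assouad_dim_lt X a : (assouad_dim X < a%:E)%E ->
  exists2 C, 0 < C & assouad_bound X a C.
Proof.
move=> /ereal_inf_ltP [_ [b [_ [C [C0 bound]]] <-]]; rewrite lte_fin => ba.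
exists C => // r Rr x r0 rR Xx; apply: le_trans (bound _ _ _ r0 rR Xx) _.
by rewrite lee_fin ler_pM2l // ler_powR ?ltW // ltr_pdivlMr // mul1r.
Qed.

Lemma upper_assouad_spectrum_lt theta X a : (upper_assouad_spectrum theta X < a%:E)%E ->
  exists2 C, 0 < C & spectrum_bound theta X a C.
Proof.
move=> /ereal_inf_ltP [_ [b [_ [C [C0 bound]]] <-]]; rewrite lte_fin => ba.
exists C => // r Rr x r0 rRt RtR R1 Xx; apply: le_trans (bound _ _ _ r0 rRt RtR R1 Xx) _.
rewrite lee_fin ler_pM2l // ler_powR ?ltW // ltr_pdivlMr // mul1r.
exact: le_lt_trans rRt RtR.
Qed.

Lemma coverable_of_assouad_bound X a C r :
  assouad_bound X a C -> ebounded X -> 0 < r -> exists n, coverable X r n.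
Proof.
move=> bound [M XM] r0; have [->|/set0P [x Xx]] := eqVneq X set0.
  by exists 0%N, (fun=> set0); split => //; exact: sub0set.
have M0 : 0 <= M by exact: le_trans (edist_ge0 _ _) (XM _ Xx).
have subX : X `<=` eball x (2 * M + r + 1) `&` X.
  move=> y Xy; split => //; rewrite /eball /=.
  have := edist_triangle 0 x y; rewrite [edist x 0]edistC.
  by have := XM _ Xx; have := XM _ Xy; lra.
have [n [F [Fr EF]]] : exists n, coverable (eball x (2 * M + r + 1) `&` X) r n.
  apply/coverable_of_covnum_lty/le_lt_trans/ltry.
  by apply: bound => //; lra.
by exists n, F; split => //; exact: subset_trans EF.
Qed.

Definition ball_covering_bound X s m C : Prop :=
  forall r Rr y, 0 < r -> r < Rr -> Rr < 1 -> X y ->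
    (covnum (eball y Rr `&` X) r <= (C * (r `^ (- m) * (Rr / r) `^ s))%:E)%E.

Lemma powR_ratio_le r Rr a s m : 0 < r -> 0 < Rr -> 0 < a -> 0 <= m ->
  Rr / r <= r `^ (- a) -> (Rr / r) `^ (m / a + s) <= r `^ (- m) * (Rr / r) `^ s.
Proof.
move=> r0 R0 a0 m0 Rra; have Rr0 : 0 < Rr / r by rewrite divr_gt0.
rewrite powRD ?(gt_eqF Rr0) ?implybT // ler_pM2r ?powR_gt0 //.
have -> : - m = - a * (m / a) by rewrite mulNr mulrC divfK ?gt_eqF.
by rewrite [leRHS]powRrM; apply: ge0_ler_powR; rewrite ?nnegrE ?powR_ge0 ?divr_ge0 // ltW.
Qed.

(* The spectrum controls the balls of radius [Rr] with [r <= Rr `^ theta^-1],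
   for which [Rr / r <= r^-1]; the smaller balls satisfy [Rr / r <= r `^ (theta - 1)]. *)
Lemma ball_covering_bound_of_spectrum theta X s m C1 C2 :
  0 < theta -> theta < 1 -> 0 <= m -> 0 < C1 -> 0 < C2 ->
  spectrum_bound theta X (m + s) C1 -> assouad_bound X (m / (1 - theta) + s) C2 ->
  ball_covering_bound X s m (C1 + C2).
Proof.
move=> th0 th1 m0 C10 C20 spec ass r Rr y r0 rR R1 Xy.
have R0 : 0 < Rr by exact: lt_trans rR.
have rhs0 : 0 <= r `^ (- m) * (Rr / r) `^ s by rewrite mulr_ge0 ?powR_ge0.
have [rRt|Rtr] := leP r (Rr `^ theta^-1).
- have RtR : Rr `^ theta^-1 < Rr.
    rewrite -ltr_ln ?posrE ?powR_gt0 // ln_powR -[ltRHS]mul1r ltr_nM2r ?invf_gt1 //.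
    by rewrite ln_lt0 // R0.
  apply: le_trans (spec _ _ _ r0 rRt RtR R1 Xy) _.
  rewrite lee_fin mulrDl; apply: ler_wpDr; first by rewrite mulr_ge0 // ltW.
  rewrite ler_pM2l // -[in leLHS](divr1 m); apply: powR_ratio_le => //.
  by rewrite powR_inv1 ?(ltW r0) // ger_pMl ?invr_gt0 // ltW.
- apply: le_trans (ass _ _ _ r0 rR Xy) _.
  rewrite lee_fin mulrDl; apply: ler_wpDl; first by rewrite mulr_ge0 // ltW.
  rewrite ler_pM2l //; apply: powR_ratio_le; rewrite ?subr_gt0 // opprB.
  rewrite powRD ?(gt_eqF r0) ?implybT // powR_inv1 ?(ltW r0) // ler_pM2r ?invr_gt0 //.
  have -> : Rr = (Rr `^ theta^-1) `^ theta.
    by rewrite -powRrM mulVf ?gt_eqF // powRr1 // ltW.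
  by apply: ge0_ler_powR (ltW Rtr); rewrite ?nnegrE ?powR_ge0 // ltW.
Qed.

Lemma card_separated_ball_le X s m C r Rr (I : finType) (x : I -> 'rV[R]_d) i :
  ball_covering_bound X s m C -> (forall j, X (x j)) -> separated r x ->
  0 < r -> r < Rr -> Rr < 1 ->
  #|[set j | (edist (x i) (x j) < Rr)%R]%SET|%:R <= C * (r `^ (- m) * (Rr / r) `^ s).
Proof.
move=> bound xX sep r0 rR R1; rewrite -lee_fin.
apply: le_trans (bound _ _ _ r0 rR R1 (xX i)); apply: card_separated_le_covnum sep.
by move=> j; rewrite finset.in_set => xij; split => //; exact: xX.
Qed.

End BallCovering.

Section DyadicScales.
Variable R : realType.
Implicit Types (rho t e : R) (j : nat).

Lemma exists_dyadic_interval t : 1 <= t -> exists j, 2 ^+ j <= t < 2 ^+ j.+1.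
Proof.
move=> t1; have t0 : 0 <= t by exact: le_trans t1.
have /andP [nt tn] := truncn_itv t0.
have n0 : (0 < Num.truncn t)%N by rewrite truncn_gt0.
have /andP [jn nj] := trunc_log_bounds (isT : (1 < 2)%N) n0.
exists (trunc_log 2 (Num.truncn t)); rewrite -!natrX; apply/andP; split.
  by apply: le_trans nt; rewrite ler_nat.
by apply: lt_le_trans tn _; rewrite ler_nat.
Qed.

Definition dyadic_depth rho : nat := Num.truncn (- ln rho / ln 2).

Lemma dyadic_depth_gt rho j : 0 < rho -> 2 ^+ j.+1 * rho < 1 -> (j < dyadic_depth rho)%N.
Proof.
move=> rho0 jrho; have ln2 : 0 < ln 2 :> R by rewrite ln_gt0 // ltr1n.
have jln : j.+1%:R * ln 2 <= - ln rho.
  rewrite mulr_natl -lnXn // -subr_ge0 -opprD oppr_ge0 addrC -lnM ?posrE ?exprn_gt0 //.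
  exact/ln_le0/ltW.
have lnrho : 0 <= - ln rho by apply: le_trans jln; rewrite mulr_ge0 // ltW.
by rewrite truncn_ge_nat ?divr_ge0 ?(ltW ln2) // ler_pdivlMr.
Qed.

Lemma dyadic_depth_le rho e : 0 < rho -> rho < 1 -> 0 < e ->
  (dyadic_depth rho)%:R <= (e * ln 2)^-1 * rho `^ (- e).
Proof.
move=> rho0 rho1 e0; have ln2 : 0 < ln 2 :> R by rewrite ln_gt0 // ltr1n.
have lnrho : 0 < - ln rho by rewrite oppr_gt0 ln_lt0 // rho0.
have /andP [/le_trans + _] := truncn_itv (divr_ge0 (ltW lnrho) (ltW ln2)); apply.
rewrite invfM mulrAC ler_pM2r ?invr_gt0 // ler_pdivlMl // mulrN -mulNr -ln_powR.
exact/ltW/ln_sublinear/powR_gt0.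
Qed.

End DyadicScales.

(** * Pairs of points with close projections *)

Section NearCollisions.
Variables (R : realType) (d : nat) (I : finType) (x : I -> 'rV[R]_d) (delta rho : R).

(* Pairs further apart than [delta] are discarded, since the covering bounds only
   concern balls of radius less than [1]. *)
Definition near_collision (p : I * I) : set (BorelMx R d) :=
  if edist (x p.1) (x p.2) <= delta then small_projection (x p.1 - x p.2) rho else set0.

Lemma measurable_near_collision p : measurable (near_collision p).
Proof.
rewrite /near_collision; case: ifP => _; last exact: measurable0.
exact: measurable_small_projection.
Qed.

Lemma sqr_card_le_hits_near_collision (X : set 'rV[R]_d) (P : 'M[R]_d) (K N : nat) :
  (forall i, X (x i)) -> coverable X delta K -> coverable (projV P X) rho N ->
  #|I|%:R ^+ 2 <= N%:R * K%:R * hits R near_collision P.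
Proof.
move=> xX [E [EK XE]] [F [FN PF]].
have /choice [c cP] : forall i, exists c : 'I_N * 'I_K, F c.1 (x i *m P) /\ E c.2 (x i).
  move=> i; have [b bK Eb] := XE _ (xX i).
  have [|a aN Fa] := PF (x i *m P); first by exists (x i).
  by exists (Ordinal aN, Ordinal bK).
have := leq_sqr_card_collisions c; rewrite card_prod !card_ord -(ler_nat R) natrX !natrM.
move=> /le_trans; apply; rewrite ler_wpM2l ?mulr_ge0 // natr_sum; apply: ler_sum.
move=> -[i j] _ /=; case: eqP => [cij|_]; last by rewrite indicE ler0n.
have [Fi Ei] := cP i; have [Fj Ej] := cP j; rewrite -cij in Fj Ej.
have near : edist (x i) (x j) <= delta.
  by have /ediam_leP := EK _ (ltn_ord (c i).2); apply.
rewrite indicE mem_set //= /near_collision /= near /small_projection /=.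
by rewrite mulmxBl -edistE; have /ediam_leP := FN _ (ltn_ord (c i).1); apply.
Qed.

Variables (k : nat) (gamma : probability (BorelMx R d) R).
Hypothesis gamma_inv : @rotation_invariant_grass_measure R d k gamma.
Hypotheses (rho0 : 0 < rho) (rho_delta : 2 * (rho + delta) < 1).

Definition dyadic_radius (j : nat) : R := 2 ^+ j.+1 * rho.

Definition shell_weight (j : nat) : R := (projection_const R d / 2 ^+ j) ^+ k.

Lemma shell_weight_ge0 j : 0 <= shell_weight j.
Proof. by rewrite exprn_ge0 // divr_ge0 ?exprn_ge0 // mulr_ge0. Qed.

Lemma gamma_small_projection_dyadic (z : 'rV[R]_d) : enorm z <= delta ->
  exists j, [/\ dyadic_radius j < 1, enorm z < dyadic_radius j &
    (gamma (small_projection z rho) <= (shell_weight j)%:E)%E].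
Proof.
move=> zdelta; have z0 := enorm_ge0 z.
have [|j] := @exists_dyadic_interval R ((rho + enorm z) / rho).
  by rewrite ler_pdivlMr // mul1r lerDl.
rewrite ler_pdivlMr // ltr_pdivrMr // => /andP [jz zj].
exists j; split.
- apply: le_lt_trans rho_delta; rewrite /dyadic_radius exprS -mulrA ler_pM2l //.
  by apply: le_trans jz _; rewrite lerD2l.
- by apply: le_lt_trans zj; rewrite lerDr ltW.
apply: le_trans (gamma_small_projection_le gamma_inv z rho0) _.
have rhoz : 0 < rho + enorm z by rewrite ltr_wpDr.
have pc0 : 0 <= projection_const R d by rewrite mulr_ge0.
rewrite lee_fin lerXn2r ?nnegrE ?mulr_ge0 ?invr_ge0 ?exprn_ge0 //; try exact: ltW.
by rewrite ler_wpM2l // ler_pdivrMr // mulrC ler_pdivlMr ?exprn_gt0 // mulrC.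
Qed.

Lemma gamma_near_collision_le i i' : (gamma (near_collision (i, i')) <=
  (\sum_(j < dyadic_depth rho | dyadic_radius j < 1)
     (edist (x i) (x i') < dyadic_radius j)%R%:R * shell_weight j)%:E)%E.
Proof.
have w0 j : 0 <= (edist (x i) (x i') < dyadic_radius j)%R%:R * shell_weight j.
  by rewrite mulr_ge0 // shell_weight_ge0.
rewrite /near_collision /=; case: ifP => [near|_]; last by rewrite measure0 lee_fin sumr_ge0.
have := @gamma_small_projection_dyadic (x i - x i').
rewrite -edistE => /(_ near) [j [j1 xj /le_trans]]; apply.
rewrite lee_fin (bigD1 (Ordinal (dyadic_depth_gt rho0 j1))) //=.
by rewrite xj mul1r lerDl sumr_ge0.
Qed.

Variables (X : set 'rV[R]_d) (m C : R).
Hypothesis bound : ball_covering_bound X k%:R m C.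
Hypotheses (xX : forall i, X (x i)) (sep : separated rho x).

Definition shell_const : R := (2 * projection_const R d) ^+ k * C.

Lemma shell_const_gt0 : 0 < C -> 0 < shell_const.
Proof. by move=> C0; rewrite mulr_gt0 // exprn_gt0 // !mulr_gt0. Qed.

Lemma sum_shell_weight_le i j : dyadic_radius j < 1 ->
  \sum_i' (edist (x i) (x i') < dyadic_radius j)%R%:R * shell_weight j <=
  shell_const * rho `^ (- m).
Proof.
move=> j1; have rhoj : rho < dyadic_radius j by rewrite ltr_pMl // exprn_egt1 // ltr1n.
have := card_separated_ball_le i bound xX sep rho0 rhoj j1.
rewrite [dyadic_radius j / rho]mulfK ?gt_eqF // powR_mulrn ?exprn_ge0 //.
move=> /(ler_wpM2l (shell_weight_ge0 j)).
rewrite -mulr_suml mulrC -sum1_card natr_sum big_mkcond /=.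
under eq_bigr do rewrite finset.in_set -mulrb.
move=> /le_trans; apply; rewrite [leLHS](_ : _ = shell_const * rho `^ (- m)) //.
by rewrite /shell_weight /shell_const expr_div_n !exprMn exprS exprMn; field;
  rewrite !expf_neq0.
Qed.

Lemma sum_gamma_near_collision_le : 0 < C ->
  (\sum_p gamma (near_collision p) <=
   (#|I|%:R * ((dyadic_depth rho)%:R * (shell_const * rho `^ (- m))))%:E)%E.
Proof.
move=> C0; have const0 : 0 <= shell_const * rho `^ (- m).
  by rewrite mulr_ge0 ?powR_ge0 // ltW // shell_const_gt0.
rewrite -(pair_bigA _ (fun i i' => gamma (near_collision (i, i')))) /=.
rewrite mulr_natl -sumr_const -sumEFin; apply: lee_sum => i _.
apply: le_trans; first by apply: lee_sum => i' _; exact: gamma_near_collision_le.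
rewrite sumEFin lee_fin exchange_big /=.
apply: le_trans; first by apply: ler_sum => j; exact: sum_shell_weight_le.
rewrite sumr_const -[leLHS]mulr_natl ler_wpM2r // ler_nat.
by rewrite -[leqRHS]card_ord max_card.
Qed.

Lemma gamma_many_near_collisions_le e : (0 < #|I|)%N -> 0 < C -> rho < 1 -> 0 < e ->
  (gamma [set P | (#|I|%:R * rho `^ (- (m + 2 * e)) <= hits R near_collision P)%R] <=
   ((e * ln 2)^-1 * shell_const * rho `^ e)%:E)%E.
Proof.
move=> I0 C0 rho1 e0; have mB := measurable_near_collision.
have IR0 : 0 < #|I|%:R :> R by rewrite ltr0n.
have const0 := shell_const_gt0 C0.
have rhoE : rho `^ (- (m + 2 * e)) * rho `^ e = rho `^ (- e) * rho `^ (- m).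
  by rewrite -!powRD ?(gt_eqF rho0) ?implybT //; congr (_ `^ _); ring.
set lambda := _ * rho `^ (- (m + 2 * e)); set G := [set P | _].
have lambda0 : 0 < lambda by rewrite mulr_gt0 ?powR_gt0.
have gfin : gamma G \is a fin_num by apply: fin_num_measure; exact: measurable_hits_ge.
have markov : (lambda%:E * gamma G <=
    (#|I|%:R * ((dyadic_depth rho)%:R * (shell_const * rho `^ (- m))))%:E)%E.
  exact: le_trans (markov_hits gamma mB (ltW lambda0)) (sum_gamma_near_collision_le C0).
move: markov; rewrite -(fineK gfin) -EFinM !lee_fin => markov.
rewrite -(ler_pM2l lambda0); apply: le_trans markov _; rewrite /lambda -[leRHS]mulrA ler_pM2l //.
apply: le_trans (_ : (e * ln 2)^-1 * rho `^ (- e) * (shell_const * rho `^ (- m)) <= _).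
  by rewrite ler_pM2r ?dyadic_depth_le // mulr_gt0 ?powR_gt0.
by rewrite [leRHS]mulrCA rhoE mulrACA.
Qed.

End NearCollisions.

(** * Box dimension of projections *)

Section ExtendedReals.
Variable R : realType.
Implicit Types (t : R) (a b s M : \bar R).

Lemma exists_ratr_between a b : (a < b)%E -> exists q : rat, (a < (ratr q)%:E < b)%E.
Proof.
have ratr_itv (u v : R) : u < v -> exists q, (u%:E < (ratr q)%:E < v%:E)%E.
  by move=> /rat_in_itvoo [q]; rewrite in_itv /= -!lte_fin; exists q.
case: a b => [u| |] [v| |] //; rewrite ?lte_fin => uv.
- exact: ratr_itv.
- have [|q /andP [uq _]] := ratr_itv u (u + 1); first by rewrite ltrDl.
  by exists q; rewrite uq ltry.
- have [|q /andP [_ qv]] := ratr_itv (v - 1) v; first by rewrite gtrBl.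
  by exists q; rewrite qv ltNyr.
- by exists 0; rewrite ltNyr ltry.
Qed.

Lemma lteB_exists_real t s M : (0 <= M)%E -> (t%:E < s - M)%E ->
  exists2 m : R, (M < m%:E)%E & ((t + m)%:E < s)%E.
Proof.
case: M => [M| |] // _; last by case: s.
rewrite lteBrDr // => /exists_ratr_between [q /andP [tMq qs]].
by exists (ratr q - t); [rewrite lte_fin ltrBrDl -lte_fin EFinD|rewrite subrKC].
Qed.

Lemma lt_limf_esup_exists (I : choiceType) (T : filteredType I) (F : set_system T)
    (f : T -> \bar R) a (Q : set T) :
  (a < limf_esup f F)%E -> F Q -> exists2 x, Q x & (a < f x)%E.
Proof.
move=> af FQ; have : (a < ereal_sup (f @` Q))%E.
  by apply: lt_le_trans af _; apply: ereal_inf_lbound; exists Q.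
by move=> /ereal_sup_gtP [_ [x Qx <-] afx]; exists x.
Qed.

Lemma limf_esup_lt_near (I : choiceType) (T : filteredType I) (F : set_system T)
    (f : T -> \bar R) a : Filter F -> (limf_esup f F < a)%E -> \forall x \near F, (f x < a)%E.
Proof.
move=> FF /ereal_inf_ltP [_ [V FV <-] fVa]; apply: filterS FV => x Vx.
by apply: le_lt_trans fVa; apply: ereal_sup_ubound; exists x.
Qed.

Lemma near_right0_exists (Q : set R) : (\forall r \near 0^'+, Q r) ->
  exists2 delta, 0 < delta & forall r, 0 < r -> r < delta -> Q r.
Proof.
move=> [delta /= delta0 deltaQ]; exists delta => // r r0 rdelta.
by apply: deltaQ => //=; rewrite sub0r normrN gtr0_norm.
Qed.

Context (dsp : measure_display) (T : measurableType dsp).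
Variable mu : {measure set T -> \bar R}.

Lemma ae_lee_of_negligible_lt (f : T -> \bar R) a :
  (forall t, (t%:E < a)%E -> mu.-negligible [set x | (f x < t%:E)%E]) ->
  {ae mu, forall x, (a <= f x)%E}.
Proof.
move=> negl; pose t n : R := ratr (odflt 0 (unpickle n : option rat)).
pose B n := if ((t n)%:E < a)%E then [set x | (f x < (t n)%:E)%E] else set0.
apply: negligibleS (negligible_bigcup (F := B) _) => [x /= /negP|n]; last first.
  by rewrite /B; case: ifP => [/negl //|_]; exact: negligible_set0.
rewrite -ltNge => /exists_ratr_between [q /andP [fq qa]].
have tq : t (pickle q) = ratr q by rewrite /t pickleK.
by exists (pickle q) => //; rewrite /B tq qa.
Qed.

Lemma negligible_of_small_covers (B : set T) :
  (forall e : R, 0 < e -> exists G, [/\ measurable G, (mu G <= e%:E)%E & B `<=` G]) ->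
  mu.-negligible B.
Proof.
move=> small; have /choice [G GP] (n : nat) : exists G,
    [/\ measurable G, (mu G <= (n.+1%:R^-1 : R)%:E)%E & B `<=` G].
  by apply: small; rewrite invr_gt0.
have mG : measurable (\bigcap_n G n) by apply: bigcap_measurable => // n _; have [] := GP n.
exists (\bigcap_n G n); split => //; last by move=> x Bx n _; have [_ _] := GP n; apply.
apply/eqP; rewrite eq_le measure_ge0 andbT; apply/lee_addgt0Pr => e e0; rewrite add0e.
have [n ne] := ltr_add_invr e0; have [mGn Gn _] := GP n.
apply: (@le_trans _ _ (mu (G n))).
  by apply: le_measure; rewrite ?inE // => x; apply.
by apply: le_trans Gn _; rewrite lee_fin -[n.+1%:R^-1]add0r ltW.
Qed.

End ExtendedReals.

Section BoxRatio.
Variables (R : realType) (d : nat).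
Implicit Types (E X : set 'rV[R]_d) (r t : R).

Lemma covnum_ge1 E r : E !=set0 -> (1%:E <= covnum E r)%E.
Proof.
move=> [x Ex]; apply/le_covnumP => n [F [_ EF]].
by rewrite ler1n; have [i /= ni _] := EF _ Ex; apply: leq_ltn_trans ni.
Qed.

Lemma le_box_ratio E r t : E !=set0 -> 0 < r -> r < 1 ->
  (t%:E <= box_ratio E r)%E = ((r `^ (- t))%:E <= covnum E r)%E.
Proof.
move=> E0 r0 r1; have := covnum_ge1 r E0; rewrite /box_ratio.
case: (covnum E r) => [N| |]; rewrite ?leey // !lee_fin => N1.
have lnr : 0 < - ln r by rewrite oppr_gt0 ln_lt0 // r0.
rewrite ler_pdivlMr // mulrN -mulNr -ln_powR ler_ln ?posrE ?powR_gt0 //.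
exact: lt_le_trans N1.
Qed.

Lemma upper_box_dim_gt_separated X t (Q : set R) : X !=set0 ->
  (t%:E < upper_box_dim X)%E -> (\forall rho \near 0^'+, Q rho) ->
  exists rho n (x : 'I_n.+1 -> 'rV[R]_d), [/\ 0 < rho, Q rho, forall i, X (x i),
    separated rho x & rho `^ (- t) <= n.+1%:R].
Proof.
move=> X0 /exists_ratr_between [q /andP []]; move: (ratr q : R) => u.
rewrite lte_fin => tu uX /near_right0_exists [delta delta0 deltaQ].
have [r [r0 rdelta r1 rtu] ur] : exists2 r, [/\ 0 < r, r < delta, r < 1 &
    r `^ (u - t) < 2^-1 `^ t] & (u%:E < box_ratio X r)%E.
  apply: (lt_limf_esup_exists uX); near=> r; split; near: r.
  - exact: nbhs_right_gt.
  - exact: nbhs_right_lt.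
  - exact: nbhs_right_lt.
  - by apply: (cvgr_lt _ (powR_cvg0 _)); rewrite ?subr_gt0 ?powR_gt0.
have rho0 : 0 < r / 2 by rewrite divr_gt0.
set n := Num.truncn ((r / 2) `^ (- t)).
have /andP [nle ngt] := truncn_itv (powR_ge0 (r / 2) (- t)).
have ncov : ~ coverable X r n.
  move=> cov; move: (ltW ur); rewrite le_box_ratio // => /le_covnumP /(_ _ cov).
  move=> /le_trans/(_ nle); apply/negP; rewrite -ltNge.
  rewrite powRM ?(ltW r0) ?invr_ge0 // -(ltr_pM2r (powR_gt0 u r0)).
  rewrite mulrAC -!powRD ?(gt_eqF r0) ?implybT // addNr powRr0 addrC.
  by rewrite -ltr_pdivlMr ?powR_gt0 // div1r -powRN opprK.
have [x [xX sep]] := not_coverable_separated (ltW r0) ncov.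
exists (r / 2), n, x; split => //; last exact: ltW.
by apply: deltaQ => //; apply: lt_trans rdelta; rewrite ltr_pdivrMr // ltr_pMr // ltr1n.
Unshelve. all: by end_near. Qed.

Lemma upper_box_dim_lt_ratio E t : (upper_box_dim E < t%:E)%E ->
  exists n : nat, forall r, 0 < r -> r < n.+1%:R^-1 -> (box_ratio E r < t%:E)%E.
Proof.
move=> /limf_esup_lt_near /near_right0_exists [delta delta0 deltaE].
have [n] := ltr_add_invr delta0; rewrite add0r => ndelta.
by exists n => r r0 rn; apply: deltaE => //; exact: lt_trans ndelta.
Qed.

Lemma le_box_ratio_projV (I : finType) (x : I -> 'rV[R]_d) X (P : 'M[R]_d) K delta rho m e t :
  X !=set0 -> 0 < rho -> rho < 1 -> (0 < #|I|)%N -> (forall i, X (x i)) ->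
  coverable X delta K.+1 -> rho `^ e <= K.+1%:R^-1 -> rho `^ (- (t + m + 3 * e)) <= #|I|%:R ->
  hits R (near_collision x delta rho) P < #|I|%:R * rho `^ (- (m + 2 * e)) ->
  (t%:E <= box_ratio (projV P X) rho)%E.
Proof.
move=> [a Xa] rho0 rho1 I0 xX XK rhoK rhoI few.
have IR0 : 0 < #|I|%:R :> R by rewrite ltr0n.
have pow0 u : 0 < rho `^ u by rewrite powR_gt0.
rewrite le_box_ratio //; last by exists (a *m P), a.
apply/le_covnumP => N PN.
have cardI : #|I|%:R <= N%:R * K.+1%:R * rho `^ (- (m + 2 * e)).
  rewrite -(ler_pM2l IR0) -expr2; apply: le_trans (sqr_card_le_hits_near_collision xX XK PN) _.
  by rewrite [leRHS]mulrCA ler_wpM2l ?mulr_ge0 // ltW.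
have := le_trans rhoI cardI.
rewrite -ler_pdivrMr // -powRB ?(gt_eqF rho0) ?implybT // -ler_pdivrMr //.
apply: le_trans; rewrite (_ : _ - _ = - t - e); last by ring.
rewrite powRB ?(gt_eqF rho0) ?implybT // -mulrA -invfM ler_peMr ?powR_ge0 //.
by rewrite invf_ge1 ?mulr_gt0 // -ler_pdivlMr // div1r.
Qed.

End BoxRatio.

Section Projections.
Variables (R : realType) (d k : nat) (gamma : probability (BorelMx R d) R).
Hypothesis gamma_inv : @rotation_invariant_grass_measure R d k gamma.
Variables (X : set 'rV[R]_d) (m C : R).
Hypotheses (X0 : X !=set0) (C0 : 0 < C) (bound : ball_covering_bound X k%:R m C).
Hypothesis Xcov : forall r, 0 < r -> exists n, coverable X r n.

Lemma negligible_box_ratio_projV_lt (t delta : R) :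
  0 < delta -> ((t + m)%:E < upper_box_dim X)%E ->
  gamma.-negligible [set P : BorelMx R d | forall r, 0 < r -> r < delta ->
    (box_ratio (projV (P : 'M[R]_d) X) r < t%:E)%E].
Proof.
move=> delta0 /exists_ratr_between [q /andP []]; move: (ratr q : R) => u.
rewrite lte_fin => tmu uX; pose e := (u - (t + m)) / 3.
have e0 : 0 < e by rewrite divr_gt0 ?subr_gt0.
have uE : u = t + m + 3 * e by rewrite /e; field.
have [|K XK] := @Xcov (1 / 4); first by rewrite divr_gt0.
have {}XK := leq_coverable (leqnSn K) XK.
apply: negligible_of_small_covers => eta eta0.
pose markov_const := (e * ln 2)^-1 * shell_const d k C.
have markov_const0 : 0 < markov_const.
  by rewrite mulr_gt0 ?shell_const_gt0 // invr_gt0 mulr_gt0 // ln_gt0 // ltr1n.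
have [|rho [n [x [rho0 [rhod rho4 rhoK rhoeta] xX sep nrho]]]] :=
  @upper_box_dim_gt_separated R d X u [set rho | [/\ rho < delta, rho < 1 / 4,
    rho `^ e <= K.+1%:R^-1 & rho `^ e <= eta / markov_const]] X0 uX.
  near=> rho; split; near: rho.
  - exact: nbhs_right_lt.
  - by apply: nbhs_right_lt; rewrite divr_gt0.
  - by apply: (cvgr_le _ (powR_cvg0 e0)); rewrite invr_gt0.
  - by apply: (cvgr_le _ (powR_cvg0 e0)); rewrite divr_gt0.
have rho1 : rho < 1 by lra.
have cardI : (0 < #|'I_n.+1|)%N by rewrite card_ord.
exists [set P | #|'I_n.+1|%:R * rho `^ (- (m + 2 * e)) <= hits R (near_collision x (1 / 4) rho) P].
split.
- by apply: measurable_hits_ge => p; exact: measurable_near_collision.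
- have rho_quarter : 2 * (rho + 1 / 4) < 1 by lra.
  apply: le_trans (gamma_many_near_collisions_le gamma_inv rho0 rho_quarter bound xX sep
    cardI C0 rho1 e0) _.
  by rewrite lee_fin mulrC -ler_pdivlMr.
move=> P PX; rewrite /= leNgt; apply/negP => few.
have := PX rho rho0 rhod; rewrite ltNge => /negP; apply.
apply: (le_box_ratio_projV X0 rho0 rho1 cardI xX XK rhoK _ few).
by rewrite -uE card_ord.
Unshelve. all: by end_near. Qed.

Lemma negligible_upper_box_dim_projV_lt (t : R) : ((t + m)%:E < upper_box_dim X)%E ->
  gamma.-negligible [set P : BorelMx R d | (upper_box_dim (projV (P : 'M[R]_d) X) < t%:E)%E].
Proof.
move=> tmX.
apply: negligibleS (negligible_bigcup (F := fun n => [set P : BorelMx R d | forall r,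
  0 < r -> r < n.+1%:R^-1 -> (box_ratio (projV (P : 'M[R]_d) X) r < t%:E)%E]) _) => [P|n].
  by move=> /upper_box_dim_lt_ratio [n Pn]; exists n.
by apply: negligible_box_ratio_projV_lt tmX; rewrite invr_gt0.
Qed.

End Projections.

Theorem theorem4p1 (R : realType) (d k : nat) (theta : R)
  (gamma : probability (BorelMx R d) R)
  (Hk : (1 <= k)%N /\ (k < d)%N)
  (Htheta : 0 < theta /\ theta < 1)
  (Hgamma : @rotation_invariant_grass_measure R d k gamma)
  (X : set 'rV[R]_d) (HX0 : X !=set0) (HXb : ebounded X) :
  {ae gamma, forall P : BorelMx R d, @grass R d k P ->
    (upper_box_dim (projV P X) >=
     upper_box_dim X
     - maxe 0 (maxe (upper_assouad_spectrum theta X - (k%:R)%:E)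
                    ((assouad_dim X - (k%:R)%:E) * (1 - theta)%:E)))%E}.
Proof.
have [theta0 theta1] := Htheta; have theta1' : 0 < 1 - theta by rewrite subr_gt0.
set loss := maxe 0%E _.
have ae_ge : {ae gamma, forall P : BorelMx R d,
    (upper_box_dim X - loss <= upper_box_dim (projV (P : 'M[R]_d) X))%E}.
  apply: ae_lee_of_negligible_lt => t.
  move=> /lteB_exists_real [|m]; first by rewrite /loss le_max lexx.
  rewrite !gt_max lte_fin lteBlDr // -lte_pdivlMr // lteBlDr // -!EFinD.
  move=> /and3P [m0 /upper_assouad_spectrum_lt [C1 C10 spec]].
  move=> /assouad_dim_lt [C2 C20 ass] tmX.
  apply: (negligible_upper_box_dim_projV_lt Hgamma HX0 (addr_gt0 C10 C20) _ _ tmX).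
  - exact: ball_covering_bound_of_spectrum theta0 theta1 (ltW m0) C10 C20 spec ass.
  - by move=> r; exact: coverable_of_assouad_bound ass HXb.
by apply: negligibleS ae_ge => P /= notP Pge; apply: notP.
Qed.
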